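(* Let $k\ge3$, $\delta\in\mathbb{C}^*$, $d\ge2$, and let $S(z_1,\dots,z_k)=(z_2,\dots,z_k,\delta(z_2^d-z_1))$ (a shift-like automorphism of $\mathbb{C}^k$ of type $k-1$), with positive Green's function $G^+(z)=\lim_{n\to\infty}\frac1{d^n}\log^+\|S^{(k-1)n}(z)\|$. Then for every $c>0$ and every algebraic variety $\widetilde V\subset\mathbb{C}^k$ of codimension $2$, there exists a change of coordinates, i.e. an automorphism $\Phi$ of $\mathbb{C}^k$, such that $\{z\in\mathbb{C}^k: G^+(z)<c\}\cap\Phi(\widetilde V)=\emptyset$.
   Context: $\log^+t=\max(\log t,0)$ and $S^m$ is the $m$-th iterate of $S$. *)

(* Defs.v *)
From HB Require Import structures.
From mathcomp Require Import all_boot all_order all_algebra.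
From mathcomp Require Import all_classical all_reals all_analysis.
From mathcomp Require Import complex.
Set Implicit Arguments. Unset Strict Implicit. Unset Printing Implicit Defensive.
Import Order.TTheory GRing.Theory Num.Theory.
Import numFieldNormedType.Exports.
Local Open Scope ring_scope.
Local Open Scope classical_set_scope.

Section Defs.
Variable R : realType.
Local Notation C := (R[i]).

Definition Ck (k : nat) := 'I_k -> C.

Definition cmod (z : C) : R := Num.sqrt (complex.Re z ^+ 2 + complex.Im z ^+ 2).

(* a norm on C^k (max norm; G^+ does not depend on the choice of norm) *)
Definition cknorm k (z : Ck k) : R := \big[Num.max/0]_(i < k) cmod (z i).

Definition logp (t : R) : R := Num.max (ln t) 0.

(* the shift-like map (idx m is the index m of 'I_k, valid since k >= 3;
   the default i is never used in that case) *)
(* the shift-like map S(z_1..z_k) = (z_2,..,z_k, delta (z_2^d - z_1)) ;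
   indices are 0-based: z_1 = z 0, z_2 = z 1 *)
Definition shiftS k (delta : C) (d : nat) (z : Ck k) : Ck k :=
  fun i => let idx (m : nat) : 'I_k := odflt i (insub m) in
           if (i.+1 < k)%N then z (idx i.+1)
           else delta * (z (idx 1%N) ^+ d - z (idx 0%N)).

Definition greenp k (delta : C) (d : nat) (z : Ck k) : R :=
  limn (fun n : nat => (d%:R ^+ n)^-1 *
                        logp (cknorm (iter ((k.-1) * n) (shiftS delta d) z))).

Inductive polyfun k : (Ck k -> C) -> Prop :=
| polyfun_cst (a : C) : polyfun (fun _ => a)
| polyfun_coord (i : 'I_k) : polyfun (fun z => z i)
| polyfun_add p q : polyfun p -> polyfun q -> polyfun (fun z => p z + q z)
| polyfun_mul p q : polyfun p -> polyfun q -> polyfun (fun z => p z * q z).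

Definition algebraic_set k (V : set (Ck k)) : Prop :=
  exists P : set (Ck k -> C), (forall p, P p -> polyfun p) /\
    V = [set z | forall p, P p -> p z = 0].

Definition irreducible_alg k (V : set (Ck k)) : Prop :=
  algebraic_set V /\ V !=set0 /\
  forall A B : set (Ck k), algebraic_set A -> algebraic_set B ->
    V = A `|` B -> V = A \/ V = B.

Definition irr_chain k (V : set (Ck k)) (n : nat) : Prop :=
  exists Z : nat -> set (Ck k),
    (forall i, (i <= n)%N -> irreducible_alg (Z i)) /\
    (forall i, (i < n)%N -> Z i `<` Z i.+1) /\
    Z n `<=` V.

Definition alg_dim_eq k (V : set (Ck k)) (m : nat) : Prop :=
  irr_chain V m /\ ~ irr_chain V m.+1.

Definition codim2_variety k (V : set (Ck k)) : Prop :=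
  algebraic_set V /\ alg_dim_eq V (k - 2).

Definition polymap k (F : Ck k -> Ck k) : Prop :=
  forall i : 'I_k, polyfun (fun z => F z i).

Definition poly_automorphism k (F : Ck k -> Ck k) : Prop :=
  polymap F /\ exists G : Ck k -> Ck k, polymap G /\
    cancel F G /\ cancel G F.

End Defs.

(* Main.v *)
Require Import Defs.
From HB Require Import structures.
From mathcomp Require Import all_boot all_order all_algebra.
From mathcomp Require Import all_classical all_reals all_analysis.
From mathcomp Require Import complex.
From mathcomp Require Import ring lra.
Import Order.TTheory GRing.Theory Num.Theory.
Import numFieldNormedType.Exports.
Local Open Scope ring_scope.
Local Open Scope classical_set_scope.

(* Write S^(k-1) z = (z_k, delta (z_2^d - z_1), ..., delta (z_k^d - z_(k-1))).  Once
   the largest coordinate of z is large and is not z_1, this stays true along the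
   orbit and log |S^((k-1)n) z| is multiplied by d at each step up to a bounded
   error, so G^+ z is large.  It thus suffices to push V into this region, which
   an affine map does.  Choose a direction v in which the leading form of an
   equation of V does not vanish: the projection along v is then finite on V, and
   the coordinate along v grows at most linearly in the others.  If the projection
   were onto, then intersecting V with a flag of linear subspaces containing v, and
   taking at each step a minimal algebraic subset that still projects onto the
   member of the flag, would give a chain of irreducible subsets of V of length
   k - 1.  So the image, which is Zariski closed by elimination, misses a ball;
   center this ball at the origin, blow it up, and contract the coordinate along v. *)

(** * Polynomial functions *)

Section Polyfun.
Set Implicit Arguments. Unset Strict Implicit. Unset Printing Implicit Defensive.
Variables (R : realType) (k : nat).
Local Notation C := R[i].
Local Notation Ck := (Ck R k).
Implicit Types (f g : Ck -> C) (z : Ck).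

Lemma polyfun_ext f g : polyfun f -> (forall z, f z = g z) -> polyfun g.
Proof. by move=> pf /funext <-. Qed.

Lemma polyfun_opp f : polyfun f -> polyfun (fun z => - f z).
Proof.
move=> pf; apply: (polyfun_ext (polyfun_mul (polyfun_cst k (-1)) pf)) => z.
by rewrite mulN1r.
Qed.

Lemma polyfun_sub f g : polyfun f -> polyfun g -> polyfun (fun z => f z - g z).
Proof. by move=> pf pg; apply: polyfun_add pf (polyfun_opp pg). Qed.

Lemma polyfun_sum I (r : seq I) (P : pred I) (F : I -> Ck -> C) :
  (forall i, P i -> polyfun (F i)) -> polyfun (fun z => \sum_(i <- r | P i) F i z).
Proof.
move=> pF; elim: r => [|i r IH].
  by apply: (polyfun_ext (polyfun_cst k 0)) => z; rewrite big_nil.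
case Pi: (P i); last by apply: polyfun_ext IH _ => z; rewrite big_cons Pi.
by apply: polyfun_ext (polyfun_add (pF _ Pi) IH) _ => z; rewrite big_cons Pi.
Qed.

Lemma polyfun_prod I (r : seq I) (P : pred I) (F : I -> Ck -> C) :
  (forall i, P i -> polyfun (F i)) -> polyfun (fun z => \prod_(i <- r | P i) F i z).
Proof.
move=> pF; elim: r => [|i r IH].
  by apply: (polyfun_ext (polyfun_cst k 1)) => z; rewrite big_nil.
case Pi: (P i); last by apply: polyfun_ext IH _ => z; rewrite big_cons Pi.
by apply: polyfun_ext (polyfun_mul (pF _ Pi) IH) _ => z; rewrite big_cons Pi.
Qed.

Lemma polyfun_det n (A : Ck -> 'M[C]_n) :
  (forall i j, polyfun (fun z => A z i j)) -> polyfun (fun z => \det (A z)).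
Proof.
move=> pA; apply: polyfun_sum => s _; apply: polyfun_mul; first exact: polyfun_cst.
by apply: polyfun_prod.
Qed.

(** This encodes C[z][t]; the uniform bound gives sums over the coefficients a range independent of
    [z]. *)
Definition polyfam (F : Ck -> {poly C}) : Prop :=
  (forall j, polyfun (fun z => (F z)`_j)) /\ exists N, forall z, (size (F z) <= N)%N.

Lemma polyfam_polyC f : polyfun f -> polyfam (fun z => (f z)%:P).
Proof.
move=> pf; split; last by exists 1%N => z; exact: size_polyC_leq1.
case=> [|j]; first by apply: polyfun_ext pf _ => z; rewrite coefC.
by apply: polyfun_ext (polyfun_cst k 0) _ => z; rewrite coefC.
Qed.

Lemma polyfam_cst (p : {poly C}) : polyfam (fun=> p).
Proof. by split; [move=> j; exact: polyfun_cst|exists (size p)]. Qed.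

Lemma polyfam_add F G : polyfam F -> polyfam G -> polyfam (fun z => F z + G z).
Proof.
move=> [cF [M sF]] [cG [N sG]]; split.
  by move=> j; apply: polyfun_ext (polyfun_add (cF j) (cG j)) _ => z; rewrite coefD.
exists (maxn M N) => z; apply: leq_trans (size_polyD _ _) _.
by rewrite geq_max !leq_max sF sG orbT.
Qed.

Lemma polyfam_mul F G : polyfam F -> polyfam G -> polyfam (fun z => F z * G z).
Proof.
move=> [cF [M sF]] [cG [N sG]]; split.
  move=> j; apply: (@polyfun_ext (fun z => \sum_(i < j.+1) (F z)`_i * (G z)`_(j - i))).
    by apply: polyfun_sum => i _; apply: polyfun_mul.
  by move=> z; rewrite coefM.
exists (M + N).-1 => z; apply: leq_trans (size_polyMleq _ _) _.
by rewrite -!subn1 leq_sub2r// leq_add.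
Qed.

Lemma polyfun_curve f (g : 'I_k -> Ck -> {poly C}) :
  polyfun f -> (forall i, polyfam (g i)) ->
  exists F, polyfam F /\ forall z t, (F z).[t] = f (fun i => (g i z).[t]).
Proof.
move=> pf pg; elim: pf => [a|i|p q _ [F [pF eF]] _ [G [pG eG]]|p q _ [F [pF eF]] _ [G [pG eG]]].
- by exists (fun=> a%:P); split=> [|z t]; [exact: polyfam_cst|rewrite hornerC].
- by exists (g i).
- by exists (fun z => F z + G z); split=> [|z t]; [exact: polyfam_add|rewrite hornerD eF eG].
- by exists (fun z => F z * G z); split=> [|z t]; [exact: polyfam_mul|rewrite hornerM eF eG].
Qed.

Lemma polyfun_line f (v : Ck) : polyfun f ->
  exists F, polyfam F /\ forall z t, (F z).[t] = f (fun i => z i + t * v i).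
Proof.
move=> pf; have [i|F [pF eF]] := @polyfun_curve f (fun i z => (z i)%:P + (v i)%:P * 'X) pf.
  exact: polyfam_add (polyfam_polyC (polyfun_coord R _)) (polyfam_cst _).
exists F; split=> // z t; rewrite eF; congr f; apply: funext => i.
by rewrite hornerD hornerMX !hornerC mulrC.
Qed.

Lemma polyfun_scaling f : polyfun f ->
  exists F, polyfam F /\ forall z t, (F z).[t] = f (fun i => t * z i).
Proof.
move=> pf; have [i|F [pF eF]] := @polyfun_curve f (fun i z => (z i)%:P * 'X) pf.
  exact: polyfam_mul (polyfam_polyC (polyfun_coord R _)) (polyfam_cst _).
exists F; split=> // z t; rewrite eF; congr f; apply: funext => i.
by rewrite hornerMX hornerC mulrC.
Qed.

End Polyfun.

(** * Univariate polynomials: values, reversal and resultants *)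

Section PolyValues.
Set Implicit Arguments. Unset Strict Implicit. Unset Printing Implicit Defensive.

Lemma poly_neq0_nonroot (F : numFieldType) (p : {poly F}) :
  p != 0 -> exists2 t, t != 0 & p.[t] != 0.
Proof.
move=> p0; apply: contrapT => H.
(* Otherwise the integers from 1 to [size p], distinct in characteristic 0, would be too many
   roots. *)
suff : (size [seq n.+1%:R : F | n <- iota 0 (size p)] < size p)%N.
  by rewrite size_map size_iota ltnn.
apply: max_poly_roots => //.
  apply/allP => _ /mapP[n _ ->]; apply: contra_notT H => h.
  by exists n.+1%:R => //; rewrite pnatr_eq0.
by rewrite map_inj_uniq ?iota_uniq// => m n /eqP; rewrite eqr_nat => /eqP [].
Qed.

Lemma poly_eq_nonzero_values (F : numFieldType) (p q : {poly F}) :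
  (forall t, t != 0 -> p.[t] = q.[t]) -> p = q.
Proof.
move=> H; apply: subr0_eq; apply/eqP; apply: contraT => /poly_neq0_nonroot[t t0].
by rewrite hornerD hornerN H// subrr eqxx.
Qed.

(** [p] is the reversal of [q] in degree [n]. Clearing denominators by a power of the variable gives
    an identity of polynomials, whose coefficients can be compared. *)
Lemma coef_reversal (F : numFieldType) (p q : {poly F}) n :
  (forall t, t != 0 -> p.[t] = t ^+ n * q.[t^-1]) ->
  (size p <= n.+1)%N /\ p`_n = q`_0.
Proof.
move=> H; pose N := size q; pose q' := \poly_(j < N.+1) q`_(N - j).
have E : 'X^N * p = 'X^n * q'.
  apply: poly_eq_nonzero_values => t t0; rewrite !hornerM !hornerXn H// mulrCA.
  congr (_ * _); rewrite horner_poly (horner_coef_wide _ (leqnSn (size q))) mulr_sumr.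
  rewrite [RHS](reindex_inj rev_ord_inj)/=; apply: eq_bigr => i _.
  have iN : (i <= N)%N by rewrite -ltnS.
  rewrite subSS subKn// mulrCA; congr (_ * _).
  by rewrite -{1}(subnK iN) exprD exprVn mulfK// expf_neq0.
have cE j : p`_j = if (N + j < n)%N then 0 else q'`_(N + j - n).
  have := congr1 (fun u : {poly F} => u`_(N + j)) E.
  by rewrite /= !coefXnM ltnNge leq_addr /= addKn.
split; last by rewrite cE ltnNge leq_addl /= addnK coef_poly ltnSn subnn.
apply/leq_sizeP => j nj; rewrite cE ltnNge (leq_trans (ltnW nj) (leq_addl _ _)) /=.
by rewrite coef_poly ltnS leqNgt ltn_subRL [(n + _)%N]addnC ltn_add2l nj.
Qed.

(** The matrix size is a free [n] rather than [(size p).-1], so that one matrix type serves a whole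
    family of polynomials. *)
Lemma char_poly_companion (F : comNzRingType) (p : {poly F}) n :
  p \is monic -> size p = n.+1 ->
  char_poly (\matrix_(i < n, j < n)
    (if (i == n.-1 :> nat)%N then - p`_j else (i.+1 == j :> nat)%:R)) = p.
Proof.
move=> mp sp; have -> : n = (size p).-1 by rewrite sp.
exact: companionmxK.
Qed.

(* [det q(A)] is, up to a unit, the resultant of [q] and [char_poly A]. *)
Lemma det_horner_mx_eq0 (F : closedFieldType) n (A : 'M[F]_n.+1) (q : {poly F}) :
  reflect (exists2 x, root (char_poly A) x & root q x) (\det (horner_mx A q) == 0).
Proof.
apply: (iffP idP) => [|[x cx qx]].
  apply: contraPP => H; apply/negP; rewrite -unitfE.
  have : coprimep (char_poly A) q.
    apply: Pdiv.ClosedField.root_coprimep => x cx.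
    by apply: contra_notN H => qx; exists x.
  case/Bezout_eq1_coprimepP => -[u w] /= uw.
  have : horner_mx A (u * char_poly A + w * q) = 1%:M by rewrite uw rmorph1.
  rewrite rmorphD !rmorphM/= Cayley_Hamilton mulr0 add0r => /(congr1 determinant).
  rewrite det1 -[_ * _]/(_ *m _) det_mulmx => /eqP; rewrite eq_sym => /eqP e.
  by rewrite unitfE; apply: contra_eq_neq e => ->; rewrite mulr0 oner_neq0.
move: cx; rewrite -eigenvalue_root_char => /eigenvalueP[v vA v0].
have /eqP qx0 := qx.
apply/det0P; exists v => //.
have [w ->] := factor_theorem _ _ qx.
rewrite mulrC rmorphM rmorphB/= horner_mx_X horner_mx_C -[_ * _]/(_ *m _) mulmxA.
by rewrite mulmxBr vA mul_mx_scalar subrr mul0mx.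
Qed.

End PolyValues.

(** * Projection along a direction *)

Section Projection.
Set Implicit Arguments. Unset Strict Implicit. Unset Printing Implicit Defensive.
Variables (R : realType) (m : nat).
Local Notation C := R[i].
Local Notation Ck := (Ck R m.+1).
Implicit Types (f g p : Ck -> C) (z a b v : Ck) (A B V W : set Ck).

Definition along v z (t : C) : Ck := fun i => z i + t * v i.

(** The degree [n.+1] is positive and common to all lines, so that the companion matrices all live
    in one matrix ring. *)
Definition monic_along v p : Prop := exists n F, polyfam F /\
  (forall z, F z \is monic /\ size (F z) = n.+2) /\
  forall z t, (F z).[t] = p (along v z t).

Lemma along0 v z : along v z 0 = z.
Proof. by apply: funext => i; rewrite /along mul0r addr0. Qed.

(** The restrictions of [f] and [g] to the line through [a] and [b] are nonzero polynomials in one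
    variable, so their product is nonzero somewhere. *)
Lemma polyfun_neq0_line f g a b : polyfun f -> polyfun g -> f a != 0 -> g b != 0 ->
  exists s, let c := along (fun i => b i - a i) a s in f c != 0 /\ g c != 0.
Proof.
move=> pf pg fa gb; set v := (X in along X).
have [F [_ eF]] := polyfun_line v pf; have [G [_ eG]] := polyfun_line v pg.
have : F a * G a != 0.
  rewrite mulf_neq0//; apply/eqP => E.
    by move: fa; rewrite -(along0 v a) -eF E horner0 eqxx.
  move: gb; suff -> : b = along v a 1 by rewrite -eG E horner0 eqxx.
  by apply: funext => i; rewrite /along mul1r subrKC.
case/poly_neq0_nonroot => s _; rewrite hornerM mulf_eq0 => /norP[].
by rewrite eF eG => fs gs; exists s.
Qed.

Lemma algebraic_separate A y : algebraic_set A -> ~ A y ->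
  exists f, [/\ polyfun f, forall z, A z -> f z = 0 & f y != 0].
Proof.
case=> P [pP ->] /existsNP[f] /not_implyP[Pf fy].
by exists f; split; [exact: pP|move=> z; exact|exact/eqP].
Qed.

(** Interpolation along the line: the old equation gets a factor vanishing at the new point, an
    equation separating the new point gets factors vanishing at the old ones. At each point exactly
    one of the two terms survives. *)
Lemma algebraic_separate_seq v a A (rs : seq C) : v ord0 = 1 -> algebraic_set A ->
  uniq rs -> (forall x, x \in rs -> ~ A (along v a x)) ->
  exists f, [/\ polyfun f, forall z, A z -> f z = 0 &
    forall x, x \in rs -> f (along v a x) != 0].
Proof.
move=> v0 aA; elim: rs => [|x rs IH] /=.
  by exists (fun=> 0); split=> //; exact: polyfun_cst.
move=> /andP[xrs urs] H.
have [|f [pf fA fx]] := IH urs; first by move=> y yrs; apply: H; rewrite inE yrs orbT.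
have [|g [pg gA gx]] := @algebraic_separate A (along v a x) aA.
  by apply: H; rewrite mem_head.
(* on the line, the coordinate [z ord0 - a ord0] is the parameter *)
have tE t : along v a t ord0 - a ord0 = t by rewrite /along v0 mulr1 addrC addKr.
have pt (y : C) : polyfun (fun z => z ord0 - a ord0 - y).
  by do !apply: polyfun_sub; [exact: polyfun_coord|exact: polyfun_cst..].
exists (fun z => f z * (z ord0 - a ord0 - x) +
                 g z * \prod_(y <- rs) (z ord0 - a ord0 - y)); split.
- apply: polyfun_add; apply: polyfun_mul => //.
  by apply: polyfun_prod => y _.
- by move=> z Az; rewrite fA// gA// !mul0r addr0.
move=> y; rewrite inE tE => /orP[/eqP->|yrs].
  rewrite subrr mulr0 add0r mulf_neq0// prodf_seq_neq0; apply/allP => w wrs /=.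
  by rewrite subr_eq0; apply: contraNneq xrs => ->.
rewrite (bigD1_seq y)//= subrr mul0r mulr0 addr0 mulf_neq0 ?fx// subr_eq0.
by apply: contraNneq xrs => <-.
Qed.

Lemma polyfun_horner_mx n (A : Ck -> 'M[C]_n.+1) (F : Ck -> {poly C}) :
  (forall i j, polyfun (fun z => A z i j)) -> polyfam F ->
  forall i j, polyfun (fun z => horner_mx (A z) (F z) i j).
Proof.
move=> pA [cF [N sF]].
have pX l : forall i j, polyfun (fun z => (A z ^+ l) i j).
  elim: l => [|l IH] i j.
    by apply: polyfun_ext (polyfun_cst _ _) _ => z; rewrite expr0.
  apply: (@polyfun_ext _ _ (fun z => \sum_h A z i h * (A z ^+ l) h j)).
    by apply: polyfun_sum => h _; apply: polyfun_mul.
  by move=> z; rewrite exprS mxE.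
move=> i j; apply: (@polyfun_ext _ _ (fun z => \sum_(l < N) (F z)`_l * (A z ^+ l) i j)).
  by apply: polyfun_sum => l _; apply: polyfun_mul.
move=> z; have FE : F z = \sum_(l < N) (F z)`_l *: 'X^l.
  rewrite -poly_def; apply/polyP => l; rewrite coef_poly.
  by case: ltnP => // lN; rewrite nth_default// (leq_trans (sF z)).
rewrite [in RHS]FE linear_sum/= summxE; apply: eq_bigr => l _.
by rewrite linearZ/= rmorphXn/= horner_mx_X mxE.
Qed.

(** Elimination: [r] is the resultant, in the parameter of the line, of [p] and an equation [f] of
    [A]. A point of [A] on the line is a common root; over [a] there is none, since [f] is chosen
    nonzero at every root of [p] there. *)
Lemma projection_closed v p A a : v ord0 = 1 -> monic_along v p ->
  algebraic_set A -> (forall z, A z -> p z = 0) -> (forall t, ~ A (along v a t)) ->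
  exists r, [/\ polyfun r, r a != 0 & forall z t, A (along v z t) -> r z = 0].
Proof.
move=> v0 [n [F [pF [mF eF]]]] aA Ap Aa.
have [[ma sa]] := mF a.
have [rs rsE] := closed_field_poly_normal (F a).
have [||f [pf fA fx]] := @algebraic_separate_seq v a A (undup rs) v0 aA.
- exact: undup_uniq.
- by move=> x _; exact: Aa.
have [G [pG eG]] := polyfun_line v pf.
pose M z : 'M[C]_n.+1 := \matrix_(i, j)
  (if (i == n :> nat)%N then - (F z)`_j else (i.+1 == j :> nat)%:R).
have charM z : char_poly (M z) = F z.
  by have [mz sz] := mF z; exact: char_poly_companion.
exists (fun z => \det (horner_mx (M z) (G z))); split.
- apply: polyfun_det; apply: polyfun_horner_mx => // i j.
  have [ei|ei] := boolP (i == n :> nat).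
    apply: polyfun_ext (polyfun_opp (pF.1 j)) _ => z.
    by rewrite mxE ei.
  by apply: polyfun_ext (polyfun_cst _ _) _ => z; rewrite mxE (negPf ei).
- apply/det_horner_mx_eq0 => -[x]; rewrite charM => Fx.
  apply/negP; rewrite /root eG fx// mem_undup.
  by move: Fx; rewrite rsE (monicP ma) scale1r root_prod_XsubC.
- move=> z t At; apply/eqP/det_horner_mx_eq0; exists t.
    by rewrite charM /root eF Ap.
  by rewrite /root eG fA.
Qed.

End Projection.

(** * Chains of irreducible sets *)

Section Chains.
Set Implicit Arguments. Unset Strict Implicit. Unset Printing Implicit Defensive.
Variables (R : realType) (m : nat).
Local Notation C := R[i].
Local Notation Ck := (Ck R m.+1).
Implicit Types (f g p : Ck -> C) (z a b v : Ck) (A B M V W Z : set Ck).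

Lemma algebraic_setI A B : algebraic_set A -> algebraic_set B -> algebraic_set (A `&` B).
Proof.
move=> [P [pP ->]] [Q [pQ ->]]; exists (P `|` Q); split; first by move=> f [/pP|/pQ].
apply/seteqP; split=> [z [Pz Qz] f [/Pz|/Qz]//|z PQ].
by split=> f ?; apply: PQ; [left|right].
Qed.

Lemma algebraic_bigcap (F : set (set Ck)) :
  (forall A, F A -> algebraic_set A) -> algebraic_set (\bigcap_(A in F) A).
Proof.
move=> aF; exists [set f | polyfun f /\ exists2 A, F A & forall z, A z -> f z = 0].
split; first by move=> f [].
apply/seteqP; split=> [z Fz f [_ [A FA]]|z H A FA]; first by apply; exact: Fz.
apply: contrapT => /(algebraic_separate (aF _ FA))[f [pf fA]] /eqP; apply.
by apply: H; split=> //; exists A.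
Qed.

Definition surjects v M W : Prop := forall a, M a -> exists t, W (along v a t).

(** Affine subspaces, in the form that lets [polyfun_neq0_line] express the irreducibility of
    [M]. *)
Definition line_closed M : Prop := forall a b s, M a -> M b ->
  M (along (fun i => b i - a i) a s).

Lemma monic_along_fiber v p a : monic_along v p ->
  exists rs : seq C, forall t, p (along v a t) = 0 -> t \in rs.
Proof.
move=> [n [F [_ [mF eF]]]]; have [rs rsE] := closed_field_poly_normal (F a).
exists rs => t pt; rewrite -root_prod_XsubC -(scale1r (\prod_(z <- rs) _)).
by rewrite -(monicP (mF a).1) -rsE /root eF pt.
Qed.

(* The fibers of the projection are finite, so that a decreasing chain of
   surjecting sets has a surjecting intersection. *)
Lemma surjects_bigcap v p M (F : set (set Ck)) :
  monic_along v p -> F !=set0 -> total_on F subset ->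
  (forall A, F A -> surjects v M A /\ forall z, A z -> p z = 0) ->
  surjects v M (\bigcap_(A in F) A).
Proof.
move=> mp [A0 FA0] tF sF a Ma; have [rs rsP] := monic_along_fiber a mp.
(* On the line through [a] only the finitely many points of [rs] count; by induction on [rs], one
   member of the chain already excludes each of them that the intersection excludes. *)
suff [A FA HA] : exists2 A, F A & forall x, x \in rs -> A (along v a x) ->
    (\bigcap_(A in F) A) (along v a x).
  have [t At] := (sF _ FA).1 _ Ma; exists t; apply: HA => //.
  by apply: rsP; exact: (sF _ FA).2.
elim: rs {rsP} => [|x rs [A FA HA]]; first by exists A0.
have [Fx|/existsNP[B /not_implyP[FB Bx]]] := pselect ((\bigcap_(A in F) A) (along v a x)).
  by exists A => // y; rewrite inE => /orP[/eqP->|]//; exact: HA.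
have [AB|BA] := tF _ _ FA FB.
  exists A => // y; rewrite inE => /orP[/eqP->|]; last exact: HA.
  by move=> /AB.
exists B => // y; rewrite inE => /orP[/eqP->//|yrs By]; apply: HA => //.
exact: BA.
Qed.

Lemma minimal_surjecting v p M W : monic_along v p -> algebraic_set W ->
  (forall z, W z -> p z = 0) -> surjects v M W ->
  exists Z, [/\ algebraic_set Z, Z `<=` W, surjects v M Z &
    forall B, algebraic_set B -> B `<=` Z -> surjects v M B -> B = Z].
Proof.
move=> mp aW Wp sW.
(* Zorn's lemma yields a maximal set, hence is applied to complements in [W]: a maximal complement
   leaves a minimal surjecting set. *)
pose good X := algebraic_set (W `\` X) /\ surjects v M (W `\` X).
have [|X [[aX sX] maxX]] := @Zorn_bigcup _ good.
  move=> F Fgood tF; have [[X0 FX0]|/set0P/negP/negPn/eqP F0] := pselect (F !=set0); last first.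
    by rewrite F0 bigcup_set0 /good setD0.
  pose F' := [set W `\` X | X in F].
  have -> : good (\bigcup_(X in F) X) =
      (algebraic_set (\bigcap_(A in F') A) /\ surjects v M (\bigcap_(A in F') A)).
    suff -> : \bigcap_(A in F') A = W `\` \bigcup_(X in F) X by [].
    apply/seteqP; split=> z.
      move=> H; split; first by have [] := H _ (imageP _ FX0).
      by move=> [X FX Xz]; have [] := H _ (imageP _ FX).
    move=> [Wz nX] _ [X FX <-]; split=> // Xz; apply: nX; by exists X.
  split.
    by apply: algebraic_bigcap => _ [X /Fgood[aX _] <-].
  apply: surjects_bigcap mp _ _ _.
  - by exists (W `\` X0); exact: imageP.
  - move=> _ _ [X FX <-] [Y FY <-]; have [XY|YX] := tF _ _ FX FY.
      by right; apply: setDS.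
    by left; apply: setDS.
  - by move=> _ [X /Fgood[_ sX] <-]; split=> // z [/Wp].
exists (W `\` X); split=> //.
move=> B aB BZ sB; apply: contrapT => BneZ.
have WB : W `\` ~` B = B.
  by rewrite setDE setCK; apply: setIidr => z /BZ[].
apply: (maxX (~` B)); last by rewrite /good WB.
split; last first.
  by move=> BX; apply: BneZ; apply/seteqP; split=> // z [Wz Xz]; apply: contrapT => /BX.
by move=> z Xz /BZ[].
Qed.

(** A minimal surjecting [Z] is irreducible. If [Z] is the union of [A] and [B], neither surjecting,
    elimination gives [r] and [q] vanishing on their projections but not at some [a], [b] in [M]. At
    a point of the line through [a] and [b] both are nonzero, so [Z] misses the fiber over it. *)
Lemma irreducible_surjecting v p M W : v ord0 = 1 -> monic_along v p ->
  algebraic_set W -> (forall z, W z -> p z = 0) -> line_closed M -> M !=set0 ->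
  surjects v M W ->
  exists Z, [/\ irreducible_alg Z, Z `<=` W & surjects v M Z].
Proof.
move=> v0 mp aW Wp lM [a0 Ma0] sW.
have [Z [aZ ZW sZ minZ]] := minimal_surjecting mp aW Wp sW.
have Zp z : Z z -> p z = 0 by move=> /ZW/Wp.
exists Z; split=> //; split=> //; split.
  by have [t Zt] := sZ _ Ma0; exists (along v a0 t).
move=> A B aA aB ZE.
have AZ : A `<=` Z by rewrite ZE; exact: subsetUl.
have BZ : B `<=` Z by rewrite ZE; exact: subsetUr.
have [sA|/existsNP[a /not_implyP[Ma /forallNP Aa]]] := pselect (surjects v M A).
  by left; rewrite (minZ A).
have [sB|/existsNP[b /not_implyP[Mb /forallNP Bb]]] := pselect (surjects v M B).
  by right; rewrite (minZ B).
have [|r [pr ra rA]] := projection_closed v0 mp aA _ Aa; first by move=> z /AZ/Zp.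
have [|q [pq qb qB]] := projection_closed v0 mp aB _ Bb; first by move=> z /BZ/Zp.
have [s [/eqP rc /eqP qc]] := polyfun_neq0_line pr pq ra qb.
by have [t] := sZ _ (lM _ _ s Ma Mb); rewrite ZE => -[/rA|/qB].
Qed.

(** When [v ord0 = 1], this is the span of [v] and the basis vectors of index 1 to [j]: of dimension
    [j] modulo [v], and the whole space for [j = m]. *)
Definition flag v (j : nat) : set Ck :=
  [set z | forall i : 'I_m.+1, (j < i)%N -> z i = v i * z ord0].

Lemma algebraic_flag v j : algebraic_set (flag v j).
Proof.
exists [set f | exists2 i : 'I_m.+1, (j < i)%N & f = fun z => z i - v i * z ord0]; split.
  move=> _ [i _ ->]; apply: polyfun_sub; first exact: polyfun_coord.
  apply: polyfun_mul; [exact: polyfun_cst|exact: polyfun_coord].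
apply/seteqP; split=> [z fz _ [i ji ->]|z H i ji]; first by rewrite fz// subrr.
by apply/eqP; rewrite -subr_eq0; apply/eqP/(H (fun z => z i - v i * z ord0)); exists i.
Qed.

Lemma line_closed_flag v j : line_closed (flag v j).
Proof. by move=> a b s Ma Mb i ji; rewrite /along Ma// Mb//; ring. Qed.

Lemma flag_along v j a t : v ord0 = 1 -> flag v j a -> flag v j (along v a t).
Proof. by move=> v0 fa i ji; rewrite /along fa// v0; ring. Qed.

(** The top member [Z] is an irreducible set surjecting onto the flag of level [j.+1]; the induction
    hypothesis, applied to [Z], gives the lower members inside the flag of level [j]. The
    intersection with the flag in the conclusion is what makes the last inclusion strict. *)
Lemma irr_chain_surjecting v p j W : v ord0 = 1 -> monic_along v p ->
  algebraic_set W -> (forall z, W z -> p z = 0) -> (j <= m)%N ->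
  surjects v (flag v j) W -> irr_chain (W `&` flag v j) j.
Proof.
move=> v0 mp; elim: j W => [|j IH] W aW Wp jm sW.
  have [|||||Z [iZ ZW _]] := @irreducible_surjecting v p (flag v 0) (W `&` flag v 0) v0 mp.
  - exact: algebraic_setI (algebraic_flag _ _).
  - by move=> z [/Wp].
  - exact: line_closed_flag.
  - by exists (fun=> 0) => i _; rewrite mulr0.
  - by move=> a fa; have [t Wt] := sW _ fa; exists t; split=> //; exact: flag_along.
  by exists (fun=> Z); split=> //; split.
have [|||||Z [iZ ZW sZ]] := @irreducible_surjecting v p (flag v j.+1) (W `&` flag v j.+1) v0 mp.
- exact: algebraic_setI (algebraic_flag _ _).
- by move=> z [/Wp].
- exact: line_closed_flag.
- by exists (fun=> 0) => i _; rewrite mulr0.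
- by move=> a fa; have [t Wt] := sW _ fa; exists t; split=> //; exact: flag_along.
have [|||Z' [iZ' [sZ' Z'Z]]] := IH Z iZ.1.
- by move=> z /ZW[/Wp].
- exact: ltnW.
- by move=> a fa; apply: sZ => i ji; apply: fa; exact: ltnW.
exists (fun l => if (l <= j)%N then Z' l else Z); split; [|split].
- by move=> l _; case: ifP => // lj; exact: iZ'.
- move=> l; rewrite ltnS => lj; rewrite lj; case: ltnP => [lj'|jl]; first exact: sZ'.
  have -> : l = j by apply/eqP; rewrite eqn_leq lj.
  split=> [z /Z'Z[]//|ZZ'].
  (* The basis vector [a] of index [j.+1] lies in the larger flag, but no translate of it along [v]
     lies in the smaller one. *)
  pose i0 : 'I_m.+1 := @Ordinal m.+1 j.+1 jm.
  pose a : Ck := fun i => (i == i0)%:R.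
  have a0 : a ord0 = 0 by [].
  have [|t Zt] := sZ a.
    move=> i ji; rewrite a0 mulr0 /a; case: eqP => // ii.
    by move: ji; rewrite ii ltnn.
  have [_ /(_ i0)] := Z'Z _ (ZZ' _ Zt).
  rewrite /along a0 v0 /a eqxx mulr1 add0r => /(_ (ltnSn j)) /eqP.
  by rewrite mulrC -subr_eq0 addrK oner_eq0.
- by rewrite ltnn.
Qed.

Lemma irr_chain_sub V W n : V `<=` W -> irr_chain V n -> irr_chain W n.
Proof. by move=> VW [Z [? [? ZV]]]; exists Z; split=> //; split=> // z /ZV/VW. Qed.

End Chains.

(** * Leading forms *)

Section Modulus.
Import ComplexField.Normc.
Set Implicit Arguments. Unset Strict Implicit. Unset Printing Implicit Defensive.
Variable R : realType.
Implicit Types x y : R[i].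

Lemma cmodE x : cmod x = normc x.
Proof. by case: x. Qed.

Lemma cmod0 : cmod (0 : R[i]) = 0.
Proof. by rewrite cmodE normc0. Qed.

Lemma cmod1 : cmod (1 : R[i]) = 1.
Proof. by rewrite cmodE normc1. Qed.

Lemma cmod_ge0 x : 0 <= cmod x.
Proof. exact: sqrtr_ge0. Qed.

Lemma cmod_gt0 x : (0 < cmod x) = (x != 0).
Proof.
rewrite lt_def cmod_ge0 andbT; congr (~~ _); apply/eqP/eqP => [|->]; last exact: cmod0.
by rewrite cmodE => /eq0_normc.
Qed.

Lemma cmodM x y : cmod (x * y) = cmod x * cmod y.
Proof. by rewrite !cmodE normcM. Qed.

Lemma cmodX x n : cmod (x ^+ n) = cmod x ^+ n.
Proof. by elim: n => [|n IH]; rewrite ?expr0 ?cmod1// !exprS cmodM IH. Qed.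

Lemma cmodV x : cmod x^-1 = (cmod x)^-1.
Proof. by rewrite !cmodE normcV. Qed.

Lemma cmodN x : cmod (- x) = cmod x.
Proof. by rewrite !cmodE normcN. Qed.

Lemma cmodD x y : cmod (x + y) <= cmod x + cmod y.
Proof. by rewrite !cmodE le_normcD. Qed.

Lemma cmodB x y : cmod (x - y) <= cmod x + cmod y.
Proof. by rewrite -(cmodN y) cmodD. Qed.

Lemma cmod_sub_ge x y : cmod x - cmod y <= cmod (x - y).
Proof. by rewrite lerBlDr -{1}(subrK y x) cmodD. Qed.

Lemma cmod_real (r : R) : 0 <= r -> cmod (r%:C)%C = r.
Proof. by move=> r0; rewrite /cmod/= expr0n/= addr0 sqrtr_sqr ger0_norm. Qed.

Lemma cmod_sum n (F : 'I_n -> R[i]) : cmod (\sum_i F i) <= \sum_i cmod (F i).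
Proof.
elim/big_rec2: _ => [|i y x _ le_xy]; first by rewrite cmod0.
by apply: le_trans (cmodD _ _) _; rewrite lerD2l.
Qed.

Lemma polyfun_continuous k (f : Ck R k -> R[i]) a (e : R) : polyfun f -> 0 < e ->
  exists2 r : R, 0 < r &
    forall z, (forall i, cmod (z i - a i) <= r) -> cmod (f z - f a) <= e.
Proof.
move=> pf; elim: pf e => [b|i|p q _ IHp _ IHq|p q _ IHp _ IHq] e e0.
- by exists 1 => // z _; rewrite subrr cmod0 ltW.
- by exists e => // z; exact.
- have [r r0 rP] := IHp (e / 2) ltac:(lra); have [s s0 sP] := IHq (e / 2) ltac:(lra).
  exists (Num.min r s); first by rewrite lt_min r0.
  move=> z /[dup] H; have := rP z; have := sP z.
  have : forall i, cmod (z i - a i) <= r by move=> i; have := H i; rewrite le_min => /andP[].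
  have : forall i, cmod (z i - a i) <= s by move=> i; have := H i; rewrite le_min => /andP[].
  move=> Hs Hr /(_ Hs) qz /(_ Hr) pz _.
  rewrite opprD addrACA; apply: le_trans (cmodD _ _) _; lra.
(* If both factors move by at most [e' <= 1], the product moves by at most e' (e' + |p a| + |q a|),
   which is at most [e' * c]. *)
- pose c := 1 + cmod (p a) + cmod (q a).
  have c0 : 0 < c by rewrite /c; have := cmod_ge0 (p a); have := cmod_ge0 (q a); lra.
  pose e' := Num.min 1 (e / c).
  have e'0 : 0 < e' by rewrite /e' lt_min ltr01 divr_gt0.
  have e'1 : e' <= 1 by rewrite /e' ge_min lexx.
  have e'c : e' * c <= e by rewrite -ler_pdivlMr// /e' ge_min lexx orbT.
  have [r r0 rP] := IHp e' e'0; have [s s0 sP] := IHq e' e'0.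
  exists (Num.min r s); first by rewrite lt_min r0.
  move=> z H; have pz : cmod (p z - p a) <= e'.
    by apply: rP => i; have := H i; rewrite le_min => /andP[].
  have qz : cmod (q z - q a) <= e'.
    by apply: sP => i; have := H i; rewrite le_min => /andP[].
  have -> : p z * q z - p a * q a =
      (p z - p a) * (q z - q a) + p a * (q z - q a) + q a * (p z - p a) by ring.
  apply: le_trans (cmodD _ _) _; apply: le_trans (lerD (cmodD _ _) (lexx _)) _.
  rewrite !cmodM; apply: le_trans e'c.
  have := cmod_ge0 (p a); have := cmod_ge0 (q a).
  have := cmod_ge0 (p z - p a); have := cmod_ge0 (q z - q a).
  rewrite /c; nra.
Qed.

End Modulus.

(** * Homogeneous parts and the choice of the direction *)

Section Direction.
Set Implicit Arguments. Unset Strict Implicit. Unset Printing Implicit Defensive.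
Variables (R : realType) (m : nat).
Local Notation C := R[i].
Local Notation Ck := (Ck R m.+1).
Implicit Types (f g p : Ck -> C) (z a b v : Ck).

Definition homogeneous n f : Prop := forall t z, f (fun i => t * z i) = t ^+ n * f z.

(** The part of degree [j] is the coefficient of t^j in f(t z); comparing the expansions of f(s t z)
    in s gives homogeneity. *)
Lemma homogeneous_parts f : polyfun f ->
  exists (N : nat) (h : nat -> Ck -> C),
    (forall j, polyfun (h j) /\ homogeneous j (h j)) /\
    forall z, f z = \sum_(j < N) h j z.
Proof.
move=> pf; have [H [[cH [N sH]] eH]] := polyfun_scaling pf.
exists N, (fun j z => (H z)`_j); split; last first.
  move=> z; transitivity (H z).[1].
    by rewrite eH; congr f; apply: funext => i; rewrite mul1r.
  rewrite (horner_coef_wide _ (sH z)); apply: eq_bigr => j _.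
  by rewrite expr1n mulr1.
move=> j; split=> // t z.
suff -> : H (fun i => t * z i) = \poly_(l < N) (t ^+ l * (H z)`_l).
  by rewrite coef_poly; case: ltnP => // Nj; rewrite nth_default ?mulr0// (leq_trans (sH z)).
apply: poly_eq_nonzero_values => s _; rewrite eH.
transitivity (H z).[s * t].
  by rewrite eH; congr f; apply: funext => i; rewrite mulrA.
rewrite (horner_coef_wide _ (sH z)) horner_poly; apply: eq_bigr => l _.
by rewrite exprMn; ring.
Qed.

Lemma leading_form f a : polyfun f -> f a != 0 ->
  exists (n : nat) (h : nat -> Ck -> C),
    [/\ forall j, polyfun (h j) /\ homogeneous j (h j),
     forall z, f z = \sum_(j < n.+1) h j z & exists b, h n b != 0].
Proof.
move=> pf fa; have [N [h [hP]]] := homogeneous_parts pf.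
elim: N => [|N IH] fE; first by move: fa; rewrite fE big_ord0 eqxx.
have [[b hb]|/forallNP hN] := pselect (exists b, h N b != 0).
  by exists N, h; split=> //; exists b.
apply: IH => z; rewrite fE big_ord_recr/=.
by have /negP/negPn/eqP -> := hN z; rewrite addr0.
Qed.

(** Near infinity the zeros of [p] avoid a cone around [v], so that [z ord0] is bounded linearly by
    the transversal coordinates [z i - v i * z ord0]. *)
Definition conic_growth v p : Prop := exists T e : R, 0 < e /\
  forall z, p z = 0 -> cmod (z ord0) <= T \/
    exists i, e * cmod (z ord0) < cmod (z i - v i * z ord0).

(** This turns the behaviour at infinity on a line of direction [v] into values near [v]. *)
Lemma homogeneous_along n f v z t : homogeneous n f -> t != 0 ->
  f (along v z t) = t ^+ n * f (along z v t^-1).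
Proof.
move=> hf t0; rewrite -hf; congr f; apply: funext => i.
by rewrite /along mulrDr mulrA divff// mul1r addrC.
Qed.

Section LeadingForm.
Variables (f : Ck -> C) (n : nat) (h : nat -> Ck -> C) (v : Ck).
Hypothesis pf : polyfun f.
Hypothesis hP : forall j, polyfun (h j) /\ homogeneous j (h j).
Hypothesis fE : forall z, f z = \sum_(j < n.+2) h j z.
Hypothesis hv : h n.+1 v != 0.

(** On the line, [f] is t^(n+1) times a polynomial in 1/t, with value [h n.+1 v] at 1/t = 0;
    [coef_reversal] reads off the degree and the leading coefficient. *)
Lemma leading_form_monic : monic_along v (fun z => (h n.+1 v)^-1 * f z).
Proof.
have [F [pF eF]] := polyfun_line v (polyfun_mul (polyfun_cst _ (h n.+1 v)^-1) pf).
exists n, F; split=> //; split=> // z.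
have /choice[Q QE] j : exists Qj : {poly C}, forall s, Qj.[s] = h j (along z v s).
  by have [G [_ eG]] := polyfun_line z (hP j).1; exists (G v).
pose q : {poly C} := (h n.+1 v)^-1 *: \sum_(j < n.+2) 'X^(n.+1 - j) * Q j.
have [t t0|sF cF] := @coef_reversal _ (F z) q n.+1.
  rewrite eF fE hornerZ horner_sum mulrCA; congr (_ * _).
  rewrite mulr_sumr; apply: eq_bigr => j _; rewrite -/(along v z t).
  rewrite (homogeneous_along v z (hP j).2 t0) hornerM hornerXn QE mulrA; congr (_ * _).
  have -> : t ^+ n.+1 = t ^+ j * t ^+ (n.+1 - j).
    by rewrite -exprD subnKC// -ltnS ltn_ord.
  by rewrite exprVn mulfK// expf_neq0.
have q0 : q`_0 = 1.
  rewrite -horner_coef0 hornerZ horner_sum big_ord_recr/= big1.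
    by rewrite add0r subnn mul1r QE along0 mulVf.
  by move=> j _; rewrite hornerM hornerXn expr0n subn_eq0 leqNgt ltn_ord mul0r.
rewrite q0 in cF.
have sz : size (F z) = n.+2.
  apply/eqP; rewrite eqn_leq sF ltnNge; apply/negP => /leq_sizeP/(_ _ (leqnn _))/eqP.
  by rewrite cF oner_eq0.
by split=> //; rewrite monicE /lead_coef sz cF.
Qed.

Lemma locally_bounded l : exists2 r : R, 0 < r & exists2 B : R, 0 <= B &
  forall z, (forall i, cmod (z i - v i) <= r) -> forall j, (j < l)%N -> cmod (h j z) <= B.
Proof.
elim: l => [|l [r r0 [B B0 H]]]; first by exists 1 => //; exists 0.
have [s s0 sP] := polyfun_continuous v (hP l).1 ltr01.
exists (Num.min r s); first by rewrite lt_min r0.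
exists (B + 1 + cmod (h l v)); first by have := cmod_ge0 (h l v); lra.
move=> z zv j; have := cmod_ge0 (h l v) => ?.
rewrite ltnS leq_eqVlt => /orP[/eqP->|jl].
  have : cmod (h l z - h l v) <= 1.
    by apply: sP => i; apply: le_trans (zv i) _; rewrite ge_min lexx orbT.
  have := cmod_sub_ge (h l z) (h l v); lra.
have : cmod (h j z) <= B.
  by apply: H => // i; apply: le_trans (zv i) _; rewrite ge_min lexx.
lra.
Qed.

(* Near the direction [v] at infinity the leading form dominates the others. *)
Lemma leading_form_growth : conic_growth v f.
Proof.
have [r r0 [B B0 rB]] := locally_bounded n.+1.
pose eta := cmod (h n.+1 v) / 2.
have eta0 : 0 < eta by rewrite /eta divr_gt0// cmod_gt0.
have [s s0 sP] := polyfun_continuous v (hP n.+1).1 eta0.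
(* For a zero in the cone with |t| >= 1, comparing the leading form with the [n.+1] lower ones gives
   eta |t|^(n+1) <= (n+1) B |t|^n; the summand 1 ensures |t| >= 1. *)
exists (1 + n.+1%:R * B / eta), (Num.min r s).
have e0 : 0 < Num.min r s by rewrite lt_min r0.
split=> // z fz; apply: contrapT => /not_orP[/negP]; rewrite -ltNge => tT /forallNP H.
set t := z ord0 in tT H.
have T0 : 0 <= n.+1%:R * B / eta by apply: divr_ge0; [exact: mulr_ge0|exact: ltW].
have t1 : 1 <= cmod t by lra.
have t0 : t != 0 by rewrite -cmod_gt0; lra.
(* [w] is the transversal part of [z], and [x] is [z] divided by [t], which is close to [v] when [z]
   is in the cone. *)
pose w : Ck := fun i => z i - v i * t.
pose x := along w v t^-1.
have zE : z = along v w t by apply: funext => i; rewrite /along /w; ring.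
have xv i : cmod (x i - v i) <= Num.min r s.
  have -> : x i - v i = t^-1 * w i by rewrite /x /along; ring.
  rewrite cmodM cmodV mulrC ler_pdivrMr ?cmod_gt0// leNgt; apply/negP; exact: H.
have xr i : cmod (x i - v i) <= r by apply: le_trans (xv i) _; rewrite ge_min lexx.
have xs i : cmod (x i - v i) <= s by apply: le_trans (xv i) _; rewrite ge_min lexx orbT.
have hx : eta <= cmod (h n.+1 x).
  have := cmod_sub_ge (h n.+1 v) (h n.+1 v - h n.+1 x).
  rewrite subKr -(cmodN (h n.+1 v - _)) opprB; have := sP x xs; rewrite /eta; lra.
have : cmod (t ^+ n.+1 * h n.+1 x) <= n.+1%:R * B * cmod t ^+ n.
  have /eqP := fz; rewrite fE big_ord_recr/= addrC addr_eq0 => /eqP.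
  rewrite {1}zE (homogeneous_along v w (hP _).2 t0) => ->; rewrite cmodN.
  apply: le_trans (cmod_sum _) _.
  rewrite -mulrA mulr_natl -[X in _ *+ X]card_ord -sumr_const; apply: ler_sum => j _.
  rewrite zE (homogeneous_along v w (hP _).2 t0) cmodM mulrC cmodX.
  apply: ler_pM; rewrite ?exprn_ge0 ?cmod_ge0 ?rB//.
  by rewrite ler_weXn2l// -ltnS.
rewrite cmodM cmodX exprSr -mulrA [leLHS]mulrC ler_pM2r; last by rewrite exprn_gt0// cmod_gt0.
move=> le; have : cmod t * eta <= n.+1%:R * B.
  by apply: le_trans le; rewrite ler_wpM2l ?cmod_ge0.
rewrite -ler_pdivlMr//; lra.
Qed.

End LeadingForm.

(** [f] takes zero and nonzero values, so its leading form has positive degree. *)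
Lemma noether_direction f a b : polyfun f -> f a = 0 -> f b != 0 ->
  exists v p, [/\ v ord0 = 1, monic_along v p, forall z, f z = 0 -> p z = 0
    & conic_growth v p].
Proof.
move=> pf fa fb; have [n [h [hP fE [c hc]]]] := leading_form pf fb.
case: n fE hc => [|n] fE hc.
  have h0 z : h 0%N z = h 0%N (fun=> 0).
    rewrite -[LHS]mul1r -(expr0 0) -(hP 0%N).2; congr (h _ _).
    by apply: funext => i; rewrite mul0r.
  move: fb; rewrite fE big_ord1 h0 -(h0 a).
  by move: fa; rewrite fE big_ord1 => ->; rewrite eqxx.
(* The leading form and the first coordinate are both nonzero at some [u]; rescaling [u] makes its
   first coordinate 1. *)
have [s] := @polyfun_neq0_line _ _ (h n.+1) (fun z => z ord0) c (fun=> 1)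
   (hP _).1 (polyfun_coord _ _) hc (oner_neq0 _).
set u := along _ _ _ => -[hu u0].
pose v : Ck := fun i => (u ord0)^-1 * u i.
have hv : h n.+1 v != 0 by rewrite (hP _).2 mulf_neq0// expf_neq0// invr_eq0.
exists v, (fun z => (h n.+1 v)^-1 * f z); split.
- by rewrite /v mulVf.
- exact: leading_form_monic.
- by move=> z ->; rewrite mulr0.
have [T [e [e0 H]]] := leading_form_growth hP fE hv.
exists T, e; split=> // z /eqP; rewrite mulf_eq0 invr_eq0 (negPf hv) => /eqP; exact: H.
Qed.

End Direction.

(** * Growth of the Green function *)

Section Dynamics.
Set Implicit Arguments. Unset Strict Implicit. Unset Printing Implicit Defensive.
Variable R : realType.

(* [(L n - B) / d ^ n] increases, [(L n + B) / d ^ n] decreases. *)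
Lemma quasi_geometric_lim (L : nat -> R) (B : R) (d : nat) : (2 <= d)%N ->
  (forall n, `|L n.+1 - d%:R * L n| <= B) ->
  L 0%N - B <= limn (fun n => (d%:R ^+ n)^-1 * L n).
Proof.
move=> d2 LB; have B0 : 0 <= B by apply: le_trans (LB 0%N); exact: normr_ge0.
have d2R : 2 <= d%:R :> R by rewrite ler_nat.
have d0 : 0 < d%:R :> R by lra.
pose b n := (d%:R ^+ n)^-1 * (L n - B).
have inv0 n : 0 <= (d%:R ^+ n : R)^-1 by rewrite invr_ge0 exprn_ge0// ltW.
have invS n : (d%:R ^+ n : R)^-1 = (d%:R ^+ n.+1)^-1 * d%:R.
  by rewrite exprSr invfM divfK// gt_eqF.
have b_ndec : nondecreasing_seq b.
  apply/nondecreasing_seqP => n; rewrite /b invS -mulrA ler_wpM2l//.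
  have := LB n; rewrite ler_norml => /andP[h1 h2].
  have : 2 * B <= d%:R * B by rewrite ler_wpM2r.
  lra.
have c_bound n : (d%:R ^+ n)^-1 * (L n + B) <= L 0%N + B.
  elim: n => [|n]; first by rewrite expr0 invr1 mul1r.
  apply: le_trans; rewrite (invS n) -mulrA ler_wpM2l//.
  have := LB n; rewrite ler_norml => /andP[h1 h2].
  have : 2 * B <= d%:R * B by rewrite ler_wpM2r.
  lra.
(* [limn] is informative only for a convergent sequence; here monotonicity and the bound give
   convergence. *)
have b_cvg : cvgn b.
  apply: nondecreasing_is_cvgn => //; exists (L 0%N + B) => _ [n _ <-].
  by apply: le_trans (c_bound n); rewrite ler_wpM2l//; lra.
have d_cvg : (fun n => B * (d%:R^-1 ^+ n)) @ \oo --> (0 : R).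
  rewrite -[0](mulr0 B); apply: cvgMr; apply: cvg_expr.
  by rewrite ger0_norm ?invr_ge0 ?ltW// invf_cp1//; lra.
have -> : limn (fun n => (d%:R ^+ n)^-1 * L n) = limn b.
  apply/cvg_lim => //; rewrite -[limn b]addr0.
  have -> : (fun n => (d%:R ^+ n)^-1 * L n) = b \+ (fun n => B * (d%:R^-1 ^+ n)).
    by apply: funext => n; rewrite /b /= exprVn; ring.
  exact: cvgD.
have := nondecreasing_cvgn_le b_ndec b_cvg 0%N.
by rewrite {1}/b expr0 invr1 mul1r.
Qed.

(** * Growth along blocks of [m] iterates *)

Variables (m : nat) (delta : R[i]) (d : nat).
Hypothesis m1 : (1 <= m)%N.
Hypothesis delta0 : delta != 0.
Hypothesis d2 : (2 <= d)%N.
Local Notation Ck := (Ck R m.+1).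
Local Notation S := (@shiftS R m.+1 delta d).
Implicit Types (y z : Ck).

Lemma cmod_le_cknorm z i : cmod (z i) <= cknorm z.
Proof. exact: le_bigmax. Qed.

Lemma cknorm_attained z : exists i, cknorm z = cmod (z i).
Proof.
have [|i _ zi] := @eq_bigmax _ _ _ 0 ord0 predT (fun i => cmod (z i)) isT.
  by move=> i _; exact: cmod_ge0.
by exists i.
Qed.

Lemma shiftS_lt y (i j : 'I_m.+1) : j = i.+1 :> nat -> S y i = y j.
Proof.
move=> ji; rewrite /shiftS -ji ltn_ord; congr y.
by rewrite valK.
Qed.

Lemma shiftS_max y (i : 'I_m.+1) : i = 1%N :> nat ->
  S y ord_max = delta * (y i ^+ d - y ord0).
Proof.
move=> i1; rewrite /shiftS ltnn -i1 valK /=.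
by rewrite (_ : insub 0%N = Some (ord0 : 'I_m.+1))//; exact: (valK ord0).
Qed.

(** An orbit is a scalar sequence, the first coordinates, of which each iterate shows a window of
    length [m.+1]. *)
Lemma iter_shift_ord0 y n (i : 'I_m.+1) : iter n S y i = iter (n + i) S y ord0.
Proof.
case: i => i; elim: i n => [|i IH] n im.
  by rewrite addn0; congr (iter n S y); exact: val_inj.
have im' := ltnW im.
by rewrite -(@shiftS_lt _ (Ordinal im') (Ordinal im))// -iterS IH addSnnS.
Qed.

Lemma iter_block0 y : iter m S y ord0 = y ord_max.
Proof. by rewrite -[RHS]/(iter 0 S y ord_max) (iter_shift_ord0 y 0). Qed.

(** The scalar sequence satisfies u(n+m+1) = delta (u(n+1)^d - u(n)); here n is [i]. *)
Lemma iter_block y (i : 'I_m) : iter m S y (lift ord0 i) =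
  delta * (y (lift ord0 i) ^+ d - y (widen_ord (leqnSn m) i)).
Proof.
have m1' : (1 < m.+1)%N by [].
rewrite iter_shift_ord0 lift0 addnC.
rewrite -(iter_shift_ord0 y i.+1 ord_max) iterS (@shiftS_max _ (Ordinal m1'))//.
congr (_ * (_ ^+ d - _)).
  by rewrite (iter_shift_ord0 y i) addn1 -[RHS]/(iter 0 S y _) (iter_shift_ord0 y 0).
by rewrite -[RHS]/(iter 0 S y _) (iter_shift_ord0 y 0).
Qed.

(** The first coordinate is set apart because a block of [m] iterates does not raise it to the power
    [d]. *)
Definition dominant z : Prop := exists i : 'I_m, cknorm z = cmod (z (lift ord0 i)).

(** With M the norm, the coordinate attaining it has an image of modulus at least |delta| (M^d - M)
    >= |delta| M (M - 1) >= M. The new first coordinate is an old one, at most M, so dominance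
    persists. *)
Lemma iter_block_dominant y : dominant y -> 2 <= cknorm y ->
  1 <= cmod delta * (cknorm y - 1) ->
  [/\ dominant (iter m S y), cknorm y <= cknorm (iter m S y),
      cmod delta * cknorm y ^+ d / 2 <= cknorm (iter m S y) &
      cknorm (iter m S y) <= cmod delta * cknorm y ^+ d * 2].
Proof.
set M := cknorm y; set y' := iter m S y => -[i iM] M2 dM.
have dp : 0 < cmod delta by rewrite cmod_gt0.
have MX : 2 * M <= M ^+ d.
  have : M ^+ 2 <= M ^+ d by rewrite ler_weXn2l//; lra.
  nra.
have MX1 : M * (M - 1) <= M ^+ d - M.
  have : M ^+ 2 <= M ^+ d by rewrite ler_weXn2l//; lra.
  rewrite expr2; lra.
have lo : cmod delta * (M ^+ d - M) <= cmod (y' (lift ord0 i)).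
  rewrite /y' iter_block cmodM ler_wpM2l ?cmod_ge0//.
  apply: le_trans (cmod_sub_ge _ _); rewrite cmodX -iM lerB//; exact: cmod_le_cknorm.
have Mlo : M <= cmod (y' (lift ord0 i)) by nra.
have hi j : cmod (y' (lift ord0 j)) <= cmod delta * (M ^+ d + M).
  rewrite /y' iter_block cmodM ler_wpM2l ?cmod_ge0//.
  apply: le_trans (cmodB _ _) _; rewrite cmodX lerD ?cmod_le_cknorm//.
  by rewrite lerXn2r ?nnegrE ?cmod_ge0 ?cmod_le_cknorm//; lra.
have loN : cmod (y' (lift ord0 i)) <= cknorm y' by exact: cmod_le_cknorm.
have [j jE] : dominant y'.
  have [j] := cknorm_attained y'; have [j0 -> jE|->] := unliftP ord0 j; first by exists j0.
  move=> E; exists i; apply/eqP; rewrite eq_le loN andbT.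
  by rewrite E /y' iter_block0; apply: le_trans Mlo; exact: cmod_le_cknorm.
split; [by exists j|lra|nra|].
by rewrite jE; apply: le_trans (hi j) _; nra.
Qed.

(** The block estimates say that the logarithm of the norm is multiplied by [d] up to an error [B],
    so [quasi_geometric_lim] applies. *)
Lemma greenp_large (c : R) : exists M : R, 0 < M /\
  forall z, dominant z -> M <= cknorm z -> c <= greenp delta d z.
Proof.
have dp : 0 < cmod delta by rewrite cmod_gt0.
pose B := `|ln (cmod delta)| + ln 2.
(* The first two bounds start the induction on blocks; the last makes the initial logarithm at least
   [c + B]. *)
pose M0 := Num.max (Num.max 2 (1 + (cmod delta)^-1)) (expR (c + B)).
exists M0; split; first by rewrite !lt_max ltr0n.
move=> z zd; rewrite !ge_max => /andP[/andP[z2 zdelta] zc].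
pose x n := iter (m * n) S z.
have xS n : x n.+1 = iter m S (x n) by rewrite /x mulnS iterD.
have xP n : [/\ dominant (x n), 2 <= cknorm (x n) &
    1 <= cmod delta * (cknorm (x n) - 1)].
  elim: n => [|n [xd x2 xdelta]].
    rewrite /x muln0 /=; split=> //.
    by rewrite mulrC -ler_pdivrMr// div1r; lra.
  have [xd' xle _ _] := iter_block_dominant xd x2 xdelta.
  rewrite xS; split=> //; first exact: le_trans xle.
  by apply: le_trans xdelta _; rewrite ler_wpM2l ?cmod_ge0// lerB.
have xpos n : 0 < cknorm (x n) by have [_ ? _] := xP n; lra.
have -> : greenp delta d z = limn (fun n => (d%:R ^+ n)^-1 * ln (cknorm (x n))).
  rewrite /greenp; congr (limn _); apply: funext => n; congr (_ * _).
  rewrite /logp max_l// ln_ge0//; have [_ h _] := xP n.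
  by apply: le_trans h; rewrite ler1n.
apply: le_trans (quasi_geometric_lim d2 (B := B) _); last first.
  move=> n; have [xd x2 xdelta] := xP n.
  have [_ _ lo hi] := iter_block_dominant xd x2 xdelta.
  rewrite -xS in lo hi.
  have Xp : 0 < cknorm (x n) ^+ d by rewrite exprn_gt0.
  have lnE : ln (cmod delta * cknorm (x n) ^+ d) = ln (cmod delta) + d%:R * ln (cknorm (x n)).
    by rewrite lnM ?posrE// lnXn// mulr_natl.
  move: lo hi; rewrite -ler_ln ?posrE ?divr_gt0 ?mulr_gt0// => lo.
  rewrite -ler_ln ?posrE ?mulr_gt0// => hi.
  move: lo hi; rewrite lnM ?posrE ?mulr_gt0 ?invr_gt0// lnV ?posrE//.
  rewrite [X in _ -> _ <= X -> _]lnM ?posrE ?mulr_gt0// lnE => lo hi.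
  have := ler_norm (ln (cmod delta)); have := ler_norm (- ln (cmod delta)).
  rewrite normrN /B ler_norml; move: lo hi; lra.
rewrite lerBrDr /x muln0 /= -[leLHS]expRK ler_ln ?posrE ?expR_gt0//.
by have := xpos 0%N; rewrite /x muln0.
Qed.

End Dynamics.

(** * The automorphism *)

Section Main.
Set Implicit Arguments. Unset Strict Implicit. Unset Printing Implicit Defensive.
Variables (R : realType) (m : nat).
Local Notation C := R[i].
Local Notation Ck := (Ck R m.+1).
Implicit Types (f p : Ck -> C) (z v b : Ck) (V : set Ck).

Lemma finite_projection V : algebraic_set V -> V !=set0 -> ~ irr_chain V m ->
  exists v p, [/\ v ord0 = 1, monic_along v p, forall z, V z -> p z = 0
    & conic_growth v p].
Proof.
move=> aV [z0 Vz0] nV; have [P [pP VE]] := aV.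
have [[f [Pf [b fb]]]|/forallNP H] := pselect (exists f, P f /\ exists b, f b != 0).
  have fV z : V z -> f z = 0 by rewrite VE => /(_ _ Pf).
  have [v [p [v0 mp fp gp]]] := noether_direction (pP _ Pf) (fV _ Vz0) fb.
  by exists v, p; split=> // z /fV/fp.
(* Otherwise [V] is the whole space: apply the chain construction to a hyperplane. *)
have VT z : V z.
  rewrite VE => f Pf; have /not_andP[//|/forallNP/(_ z)/negP/negPn/eqP//] := H f.
exfalso; apply: nV.
pose e : Ck := fun i => (i == ord0)%:R.
pose W : set Ck := [set z | z ord0 = 0].
apply: (@irr_chain_sub _ _ (W `&` flag e m)) => //.
apply: (@irr_chain_surjecting _ _ e (fun z => z ord0)) => //.
- exists 0%N, (fun z => (z ord0)%:P + 'X); split; [|split].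
  + exact: polyfam_add (polyfam_polyC (polyfun_coord _ _)) (polyfam_cst _ _).
  + by move=> z; rewrite addrC monicXaddC size_XaddC.
  + by move=> z t; rewrite hornerD hornerC hornerX /along /e eqxx mulr1.
- exists [set f | f = fun z => z ord0]; split; first by move=> _ ->; exact: polyfun_coord.
  by apply/seteqP; split=> [z Wz _ ->|z H'] //; exact: (H' (fun z => z ord0)).
- by move=> a _; exists (- a ord0); rewrite /W /= /along /e eqxx mulr1 subrr.
Qed.

Lemma avoid_polydisc V (M : R) : (0 < m)%N -> algebraic_set V -> V !=set0 ->
  ~ irr_chain V m -> 0 < M ->
  exists Phi : Ck -> Ck, poly_automorphism Phi /\
    forall z, V z -> dominant (Phi z) /\ M <= cknorm (Phi z).
Proof.
move=> m0 aV V0 nV M0; have [v [p [v0 mp Vp [T [e [e0 growth]]]]]] := finite_projection aV V0 nV.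
(* If the projection were onto, the full flag would give a chain of length [m] in [V]. *)
have [a /forallNP Va] : exists a, ~ exists t, V (along v a t).
  apply: contrapT => /forallNP sV; apply: nV.
  apply: (@irr_chain_sub _ _ (V `&` flag v m)) => [z []//|].
  apply: (irr_chain_surjecting v0 mp aV Vp (leqnn m)) => a _.
  by apply: contrapT; exact: sV.
have [r [pr ra rV]] := projection_closed v0 mp aV Vp Va.
have [|rho rho0 rhoP] := @polyfun_continuous _ _ r a (cmod (r a) / 2) pr.
  by rewrite divr_gt0// cmod_gt0.
(* [b] is the projection of [a] to the hyperplane where the first coordinate is 0; [D z] measures
   how far the projection of [z] is from it. *)
pose b : Ck := fun i => a i - v i * a ord0.
pose D z i := cmod (z i - v i * z ord0 - b i).
have far z : V z -> exists i, rho < D z i.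
  (* Slide [z] along [v] to the height of [a]: [r] vanishes there, but not on the polydisc of radius
     [rho] around [a]. *)
  move=> Vz; apply: contrapT => /forallNP near_a.
  have := rhoP (along v z (a ord0 - z ord0)) => /=.
  rewrite (rV _ (z ord0 - a ord0)); last first.
    by congr V: Vz; apply: funext => i; rewrite /along; ring.
  rewrite sub0r cmodN => H; have : 0 < cmod (r a) by rewrite cmod_gt0.
  suff : cmod (r a) <= cmod (r a) / 2 by lra.
  apply: H => i; rewrite leNgt; apply/negP => lt; apply: (near_a i).
  suff -> : D z i = cmod (along v z (a ord0 - z ord0) i - a i) by [].
  by congr cmod; rewrite /along /b; ring.
have D0 z : D z ord0 = 0 by rewrite /D /b v0 !mul1r !subrr cmod0.
(* Since [D z i > rho], the first term handles |z_0| <= T; the other two handle e |z_0| <= D +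
   |b|. *)
pose K := `|T| / rho + e^-1 + cknorm b / (rho * e).
have b0 : 0 <= cknorm b by apply: le_trans (cmod_le_cknorm b ord0); exact: cmod_ge0.
have K1 : 0 <= `|T| / rho by rewrite divr_ge0// ltW.
have K2 : 0 < e^-1 by rewrite invr_gt0.
have K3 : 0 <= cknorm b / (rho * e) by rewrite divr_ge0// mulr_ge0 ?ltW.
have K0 : 0 < K by rewrite /K; lra.
have linear z : V z -> exists2 i, rho < D z i & cmod (z ord0) <= K * D z i.
  move=> Vz; have [i Di] := far _ Vz.
  have [zT|[l zl]] := growth z (Vp _ Vz).
    exists i => //; apply: le_trans zT _; apply: le_trans (ler_norm T) _.
    have -> : `|T| = `|T| / rho * rho by rewrite divfK ?gt_eqF.
    by apply: ler_pM => //; [exact: ltW|rewrite /K; lra|exact: ltW].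
  (* The larger of the two coordinates [i] and [l] satisfies both bounds at once. *)
  have [j [Dj Dl]] : exists j, rho < D z j /\ D z l <= D z j.
    have [le|lt] := leP (D z l) (D z i); first by exists i.
    by exists l; split=> //; exact: lt_trans lt.
  exists j => //.
  have : e * cmod (z ord0) <= D z j + cknorm b.
    have := cmod_sub_ge (z l - v l * z ord0) (b l); rewrite -/(D z l).
    have := cmod_le_cknorm b l; lra.
  rewrite mulrC -ler_pdivlMr// => /le_trans; apply.
  rewrite mulrDl mulrC /K !mulrDl -addrA.
  have : cknorm b / e <= cknorm b / (rho * e) * D z j.
    rewrite invfM mulrA -[leLHS]mulr1 -!mulrA ler_wpM2l// mulrCA ler_pM2l//.
    by rewrite mulrC ler_pdivlMr// mul1r ltW.
  have : 0 <= `|T| / rho * D z j by rewrite mulr_ge0// cmod_ge0.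
  lra.
(* [lam] sends the distance [rho] to [M]; [mu] makes the first coordinate no larger than the one
   given by [linear]. *)
pose lam := M / rho; pose mu := lam / K.
have lam0 : 0 < lam by rewrite divr_gt0.
have mu0 : 0 < mu by rewrite divr_gt0.
pose lamC : C := (lam%:C)%C; pose muC : C := (mu%:C)%C.
have cl : cmod lamC = lam by rewrite cmod_real// ltW.
have cm : cmod muC = mu by rewrite cmod_real// ltW.
have lamC0 : lamC != 0 by rewrite -cmod_gt0 cl.
have muC0 : muC != 0 by rewrite -cmod_gt0 cm.
exists (fun z i => if i == ord0 then muC * z ord0
  else lamC * (z i - v i * z ord0 - b i)); split.
  have pc := polyfun_coord R; have pk := @polyfun_cst R m.+1.
  split.
    move=> i; case: (i == ord0); first exact: polyfun_mul.
    apply: polyfun_mul => //; apply: polyfun_sub => //; apply: polyfun_sub => //.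
    exact: polyfun_mul.
  exists (fun y i => if i == ord0 then muC^-1 * y ord0
    else lamC^-1 * y i + v i * (muC^-1 * y ord0) + b i); split.
    move=> i; case: (i == ord0); first exact: polyfun_mul.
    apply: polyfun_add => //; apply: polyfun_add; first exact: polyfun_mul.
    by apply: polyfun_mul => //; exact: polyfun_mul.
  split=> z; apply: funext => i; rewrite eqxx; case: eqP => [->|_].
  - by rewrite mulKf.
  - by rewrite !mulKf//; ring.
  - by rewrite mulVKf.
  - by rewrite [X in _ * X](_ : _ = lamC^-1 * z i) ?mulVKf//; ring.
move=> z Vz; set y := (y in dominant y).
have yD i : i != ord0 -> cmod (y i) = lam * D z i.
  by move=> /negPf i0; rewrite /y i0 cmodM cl.
have [i Di zi] := linear _ Vz.
have i0 : i != ord0 by apply: contraTneq Di => ->; rewrite D0 -leNgt ltW.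
have yi : cmod (y ord0) <= cmod (y i).
  rewrite (yD _ i0) /y eqxx cmodM cm /mu -mulrA ler_pM2l// mulrC ler_pdivrMr//.
  by rewrite mulrC.
split; last first.
  apply: le_trans (cmod_le_cknorm y i); rewrite yD// /lam -mulrA ler_peMr//; first exact: ltW.
  by rewrite mulrC ler_pdivlMr// mul1r ltW.
have [j] := cknorm_attained y; have [j' -> jE|-> jE] := unliftP ord0 j; first by exists j'.
move: i0 yi; have [i' -> _ yi|->] := unliftP ord0 i; last by rewrite eqxx.
by exists i'; apply/eqP; rewrite eq_le cmod_le_cknorm andbT jE.
Qed.

End Main.

Theorem theorem4p4 (R : realType) (k : nat) (delta : R[i]) (d : nat) :
  (3 <= k)%N -> delta != 0 -> (2 <= d)%N ->
  forall (c : R), 0 < c ->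
  forall Vt : set (Ck R k), codim2_variety Vt ->
  exists Phi : Ck R k -> Ck R k, poly_automorphism Phi /\
    [set z | greenp delta d z < c] `&` (Phi @` Vt) = set0.
Proof.
case: k => // m m2 delta0 d2 c _ V [aV [[Z [iZ [_ ZV]]] nV]].
have m0 : (0 < m)%N by case: (m) m2.
(* Dimension [k - 2] excludes chains of length [k - 1], which is [m]. *)
have kE : (m.+1 - 2).+1 = m by rewrite subSS subn1 prednK.
rewrite kE in nV.
have V0 : V !=set0.
  by have [_ [[z Zz] _]] := iZ _ (leqnn _); exists z; exact: ZV.
have [M [M0 MP]] := greenp_large m0 delta0 d2 c.
have [Phi [autPhi PhiP]] := avoid_polydisc m0 aV V0 nV M0.
exists Phi; split=> //; apply/seteqP; split=> // y [/= yc [z Vz zy]].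
have [dz Mz] := PhiP _ Vz; move: yc; rewrite -zy.
by rewrite ltNge MP.
Qed.
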